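(* Let $n$ be an integer with $n\geq 4$, and let $l,r$ be nonzero complex numbers such that $r^{2k}\ne1$ for $1\le k\le n$ and $r^{2k}\ne-1$ for $1\le k\le n-1$ (so that the Hecke algebras $\mathcal H(D_n)$ and $\mathcal H_{F,r^2}(n)$ are semisimple). In $V_n$ there exists a one-dimensional invariant subspace if and only if $l=\frac1{r^{4n-7}}$. If so, it is unique and it is spanned over $\mathbb Q(l,r)$ by the vector $$u=\sum_{1\leq i<j\leq n}r^{i+j}\big(\widehat{w_{ij}}+r^{2n-4}\,w_{ij}\big).$$
   Context: Put $m=\frac1r-r$ and $F=\mathbb Q(l,r)\subset\mathbb C$. $V_n$ is the $F$-vector space with basis $\{w_{ij},\widehat{w_{ij}}:1\le i<j\le n\}$. It carries endomorphisms $\nu_1,\dots,\nu_n$ defined as follows ($\overline{w_{s,t}}$ stands for either $w_{s,t}$ or $\widehat{w_{s,t}}$, same choice on both sides); they define a representation of the Cohen--Gijsbers--Wales algebra of type $D_n$. $\nu_1$: for $3\le i<j\le n$, $\nu_1(\widehat{w_{ij}})=m r^{j-5}(\widehat{w_{1,i}}-w_{1,i})+m r^{j-4}(\widehat{w_{2,i}}-w_{2,i})+m r^{i-3}(\widehat{w_{1,j}}-w_{1,j})+m r^{i-2}(\widehat{w_{2,j}}-w_{2,j})+m^2(r^{i+j-8}+r^{i+j-6})(\widehat{w_{12}}-w_{12})+r\,\widehat{w_{ij}}$; for $j\ge3$: $\nu_1(\widehat{w_{1j}})=w_{2j}$, $\nu_1(\widehat{w_{2j}})=w_{1j}+m r^{j-3}w_{12}-m\,w_{2j}$,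 $\nu_1(w_{2j})=\widehat{w_{1j}}+m r^{j-3}\widehat{w_{12}}-m\,w_{2j}$, $\nu_1(w_{1j})=\widehat{w_{2j}}+m r^{j-4}(\widehat{w_{12}}-w_{12})+m(\widehat{w_{1j}}-w_{1j})$; $\nu_1(\widehat{w_{12}})=\frac1l\widehat{w_{12}}$; $\nu_1(\overline{w_{s,t}})=r\,\overline{w_{s,t}}$ for all other basis vectors. $\nu_k$, $2\le k\le n$: $\nu_k(\overline{w_{k-1,t}})=\overline{w_{k,t}}$ for $t\ge k+1$; $\nu_k(\overline{w_{s,k-1}})=\overline{w_{s,k}}$ for $s\le k-2$; $\nu_k(\widehat{w_{k-1,k}})=r\,\widehat{w_{k-1,k}}$; $\nu_k(w_{k-1,k})=\frac1lw_{k-1,k}$; for $t\ge k+1$: $\nu_k(\widehat{w_{k,t}})=\widehat{w_{k-1,t}}+\frac ml r^{t-k-2}w_{k-1,k}-m\,\widehat{w_{k,t}}$ and $\nu_k(w_{k,t})=w_{k-1,t}+m r^{t-k-1}w_{k-1,k}-m\,w_{k,t}$; for $s\le k-2$: $\nu_k(\overline{w_{s,k}})=\overline{w_{s,k-1}}+\frac{m}{l\,r^{k-s-2}}w_{k-1,k}-m\,\overline{w_{s,k}}$; $\nu_k(\overline{w_{s,t}})=r\,\overline{w_{s,t}}$ for all other basis vectors. An invariant subspace of $V_n$ is an $F$-subspace stable under all $\nu_1,\dots,\nu_n$. $\mathcal H(D_n)$ is the $F$-algebra with generators $g_1,\dots,g_n$, the Artin relations of type $D_n$ (node $1$ joined to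 node $3$, node $i$ joined to $i+1$ for $2\le i\le n-1$) and $g_i^2+mg_i=1$; $\mathcal H_{F,r^2}(n)$ is the Iwahori--Hecke algebra of $\mathrm{Sym}(n)$ with parameter $r^2$ over $F$. *)

(* Defs.v *)
From HB Require Import structures.
From mathcomp Require Import all_boot all_order all_algebra.
From mathcomp Require Import boolp reals complex.

Set Implicit Arguments.
Unset Strict Implicit.
Unset Printing Implicit Defensive.

Import Order.TTheory GRing.Theory Num.Theory.
Local Open Scope ring_scope.

(* Q(l, r): the smallest subfield of C containing l and r. As C has
   characteristic 0, every subfield of C contains Q. *)
Section QAdjoin.
Variables (C : numFieldType) (l r : C).

Definition in_Qadj : {pred C} := fun x =>
  `[< forall S : {pred C}, divring_closed S -> l \in S -> r \in S -> x \in S >].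

Lemma in_QadjP (x : C) :
  reflect (forall S : {pred C},
             divring_closed S -> l \in S -> r \in S -> x \in S)
          (x \in in_Qadj).
Proof. exact: asboolP. Qed.

Fact Qadj_divring_closed : divring_closed in_Qadj.
Proof.
split.
- by apply/in_QadjP => S [].
- move=> x y /in_QadjP Hx /in_QadjP Hy; apply/in_QadjP => S HS Sl Sr.
  by have [_ HB _] := HS; apply: HB; [apply: Hx | apply: Hy].
- move=> x y /in_QadjP Hx /in_QadjP Hy; apply/in_QadjP => S HS Sl Sr.
  by have [_ _ HD] := HS; apply: HD; [apply: Hx | apply: Hy].
Qed.

HB.instance Definition _ :=
  GRing.isDivringClosed.Build C in_Qadj Qadj_divring_closed.

Definition Qadj : Type := {x : C | x \in in_Qadj}.

HB.instance Definition _ := SubChoice.on Qadj.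
HB.instance Definition _ := [SubChoice_isSubComUnitRing of Qadj by <:].
HB.instance Definition _ := [SubComUnitRing_isSubIntegralDomain of Qadj by <:].
HB.instance Definition _ := [SubIntegralDomain_isSubField of Qadj by <:].

Fact l_in_Qadj : l \in in_Qadj. Proof. exact/in_QadjP. Qed.
Fact r_in_Qadj : r \in in_Qadj. Proof. exact/in_QadjP. Qed.

Definition Qadj_l : Qadj := Sub l l_in_Qadj.
Definition Qadj_r : Qadj := Sub r r_in_Qadj.

End QAdjoin.

(* Pairs 1 <= i < j <= n: the elements of 'I_n.+1 are 0, ..., n, so that
   indices keep their usual values 1, ..., n. *)
Definition wpair (n : nat) : Type :=
  {p : 'I_n.+1 * 'I_n.+1 | (0 < p.1)%N && (p.1 < p.2)%N}.
HB.instance Definition _ (n : nat) := SubFinite.on (wpair n).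

(* The flag is true for the hatted basis vectors. *)
Definition Vn (F : fieldType) (n : nat) := {ffun wpair n * bool -> F^o}.
HB.instance Definition _ (F : fieldType) (n : nat) := Vector.on (Vn F n).

Section Representation.
Variables (F : fieldType) (l r : F) (n : nat).
Local Notation V := (Vn F n).

Definition mpar : F := r^-1 - r.
Local Notation m := mpar.

(* w true i j is \hat{w_ij} and w false i j is w_ij; the value is 0 unless
   1 <= i < j <= n. *)
Definition w (h : bool) (i j : nat) : V :=
  [ffun x : wpair n * bool =>
     ([&& ((val x.1).1 == i :> nat), ((val x.1).2 == j :> nat) & x.2 == h])%:R].
Local Notation hw := (w true).
Local Notation uw := (w false).

Definition nu1_img (h : bool) (i j : nat) : V :=
  if (3 <= i)%N then
    if h then
      (m * r ^ (j%:Z - 5)) *: (hw 1 i - uw 1 i)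
      + (m * r ^ (j%:Z - 4)) *: (hw 2 i - uw 2 i)
      + (m * r ^ (i%:Z - 3)) *: (hw 1 j - uw 1 j)
      + (m * r ^ (i%:Z - 2)) *: (hw 2 j - uw 2 j)
      + (m ^+ 2 * (r ^ (i%:Z + j%:Z - 8) + r ^ (i%:Z + j%:Z - 6)))
          *: (hw 1 2 - uw 1 2)
      + r *: hw i j
    else r *: uw i j
  else if (3 <= j)%N then
    match h, i with
    | true, 1%N => uw 2 j
    | true, _ => uw 1 j + (m * r ^ (j%:Z - 3)) *: uw 1 2 - m *: uw 2 j
    | false, 1%N => hw 2 j + (m * r ^ (j%:Z - 4)) *: (hw 1 2 - uw 1 2)
                    + m *: (hw 1 j - uw 1 j)
    | false, _ => hw 1 j + (m * r ^ (j%:Z - 3)) *: hw 1 2 - m *: uw 2 j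
    end
  else if h then l^-1 *: hw 1 2 else r *: uw 1 2.

(* Image of the basis vector (h, i, j), where 1 <= i < j <= n, under \nu_k for
   2 <= k <= n. The order of the tests matters: it gives j >= k+1 in the cases
   i = k-1 and i = k, and i <= k-2 in the cases j = k-1 and j = k. *)
Definition nuk_img (k : nat) (h : bool) (i j : nat) : V :=
  if (i == k.-1) && (j == k) then (if h then r else l^-1) *: w h k.-1 k
  else if i == k.-1 then w h k j
  else if j == k.-1 then w h i k
  else if i == k then
    if h then
      hw k.-1 j + (m / l * r ^ (j%:Z - k%:Z - 2)) *: uw k.-1 k - m *: hw k j
    else
      uw k.-1 j + (m * r ^ (j%:Z - k%:Z - 1)) *: uw k.-1 k - m *: uw k j
  else if j == k then
    w h i k.-1 + (m / (l * r ^ (k%:Z - i%:Z - 2))) *: uw k.-1 k - m *: w h i k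
  else r *: w h i j.

Definition nu_img (k : nat) : bool -> nat -> nat -> V :=
  if k == 1%N then nu1_img else nuk_img k.

Definition nu_fun (k : nat) (v : V) : V :=
  \sum_(x : wpair n * bool) v x *: nu_img k x.2 (val x.1).1 (val x.1).2.

Fact nu_fun_linear (k : nat) : linear (nu_fun k).
Proof.
move=> a u v; rewrite /nu_fun scaler_sumr -big_split /=.
by apply: eq_bigr => x _; rewrite !ffunE scalerDl scalerA.
Qed.
HB.instance Definition _ (k : nat) :=
  GRing.isLinear.Build F V V *:%R (nu_fun k) (nu_fun_linear k).

Definition nu (k : nat) : 'End(V) := linfun (nu_fun k).

Lemma nu_w (k : nat) (h : bool) (i j : nat) :
  (1 <= i)%N -> (i < j)%N -> (j <= n)%N -> nu k (w h i j) = nu_img k h i j.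
Proof.
move=> i_gt0 lt_ij le_jn.
have lt_in : (i < n.+1)%N by rewrite ltnS (leq_trans (ltnW lt_ij)).
have lt_jn : (j < n.+1)%N by rewrite ltnS.
have Hp : (0 < (Ordinal lt_in, Ordinal lt_jn).1)%N
          && ((Ordinal lt_in, Ordinal lt_jn).1
                < (Ordinal lt_in, Ordinal lt_jn).2)%N by rewrite /= i_gt0.
pose x0 : wpair n * bool := (exist _ (Ordinal lt_in, Ordinal lt_jn) Hp, h).
rewrite lfunE /= /nu_fun (bigD1 x0) //= !ffunE /= !eqxx scale1r.
rewrite big1 ?addr0 // => -[[[a b] ab] g] /= ne; rewrite ffunE /=.
case: and3P => [[/eqP ea /eqP eb /eqP eg]|_]; last by rewrite scale0r.
case/eqP: ne; rewrite /x0 eg; congr pair; apply: val_inj => /=.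
by congr pair; apply: val_inj.
Qed.

Definition invariant_subspace (U : {vspace V}) : Prop :=
  forall k : nat, (1 <= k <= n)%N -> (nu k @: U <= U)%VS.

Definition uvec : V :=
  \sum_(1 <= i < n.+1) \sum_(i.+1 <= j < n.+1)
    r ^+ (i + j) *: (hw i j + r ^+ (2 * n - 4) *: uw i j).

End Representation.

(* Main.v *)
Require Import Defs.
From mathcomp Require Import all_boot all_order all_algebra.
From mathcomp Require Import boolp reals complex.
From mathcomp Require Import zify ring.
Import Order.TTheory GRing.Theory Num.Theory.
Local Open Scope ring_scope.

(** A one-dimensional invariant subspace is a line spanned by a common
eigenvector [v] of all the [nu k], say with eigenvalues [a k]. Everything is
read off the coordinates [v_(h,i,j)] of [v] in the basis [w h i j] ([h] is true
for the hatted vectors), over an arbitrary field with [r] nonzero and for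
[n >= 4].

For [1 <= k < n], [nu k.+1] essentially exchanges the indices [k] and [k.+1].
If exactly one of [i], [j] lies in [{k, k.+1}] and [x], [y] are the coordinates
of [v] at [(i,j)] before and after [k] is replaced by [k.+1], the eigenvector
equation says [y = a x] and [x = (a + m) y] with [a = a k.+1]; so [x] vanishes
if and only if [y] does. Hence, for each [h], the coordinates [v_(h,i,j)] are
all zero or all nonzero ([eigen_wcoord_eq0]). On a pair disjoint from
[{k, k.+1}] the operator [nu k.+1] multiplies the coordinate by [r], and [nu 1]
does so on the pair [(3,4)]; as [n >= 4], such a pair always exists, and
therefore every eigenvalue is [r] ([eigenvalue_r]). The relations above become
[y = r x], so that [v_(h,i,j) = c_h r^(i+j)] for two scalars [c_h]
([eigen_shaped]).

For vectors of this shape all the sums occurring in the operators are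
geometric, because [m = 1/r - r] makes [m r^(2t)] telescope. The coordinate of
[nu 1 v] at [w_13] gives [c_false = r^(2n-4) c_true] ([shaped_eigen_coef]), so
that [v] is a multiple of [u]; then the coordinate of [nu 2 v] at [w_12] gives
[l = r^(7-4n)] ([shaped_eigen_l]). Conversely, under these two relations all
the coordinates of [nu k v] and [r v] agree ([shaped_nuk_eigen],
[shaped_nu1_eigen]).

The formulas for the coordinates of [nu k v] are equalities between linear
functionals, so they are checked on the basis vectors ([functional_ext]). *)

(** * Coordinates and linear functionals *)

(** The coordinate of [v] at the basis vector [w h i j], computed as the scalar
product of [v] and [w h i j]; it is 0 unless [1 <= i < j <= n]. *)
Definition wcoord {F : fieldType} {n : nat} (v : Vn F n) (h : bool) (i j : nat) : F :=
  \sum_x v x * w F n h i j x.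

(** Linear forms on [Vn F n], as a predicate on plain functions, so that it
applies to any explicit expression in the coordinates. *)
Definition functional {F : fieldType} {n : nat} (f : Vn F n -> F) :=
  forall (a : F) (u v : Vn F n), f (a *: u + v) = a * f u + f v.

Section Coordinates.
Variables (F : fieldType) (n : nat).
Local Notation V := (Vn F n).
Implicit Types (u v : V) (h : bool) (i j k s t : nat).

Lemma wcoordE v x : v x = wcoord v x.2 (val x.1).1 (val x.1).2.
Proof.
rewrite /wcoord (bigD1 x) //= ffunE !eqxx mulr1 big1 ?addr0 //.
move=> [[[a b] p] g] ne; rewrite ffunE /=.
case: and3P => [[/eqP e1 /eqP e2 /eqP e3]|]; last by rewrite mulr0.
case/eqP: ne; case: x e1 e2 e3 => [[[c d] q] e] /= /val_inj e1 /val_inj e2 e3; subst.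
by congr pair; apply: val_inj.
Qed.

Lemma functional_wcoord h i j : functional (fun v : V => wcoord v h i j).
Proof.
move=> a u v; rewrite /wcoord mulr_sumr -big_split; apply: eq_bigr => x _.
by rewrite !ffunE mulrDl -mulrA.
Qed.

Lemma functional_add (f g : V -> F) :
  functional f -> functional g -> functional (fun v => f v + g v).
Proof. by move=> lf lg a u v; rewrite lf lg; ring. Qed.

Lemma functional_opp (f : V -> F) : functional f -> functional (fun v => - f v).
Proof. by move=> lf a u v; rewrite lf; ring. Qed.

Lemma functional_mul b (f : V -> F) :
  functional f -> functional (fun v => b * f v).
Proof. by move=> lf a u v; rewrite lf; ring. Qed.

Lemma functional_sum (I : Type) (r : seq I) (f : I -> V -> F) :
  (forall x, functional (f x)) -> functional (fun v => \sum_(x <- r) f x v).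
Proof.
move=> lf a u v; rewrite mulr_sumr -big_split; apply: eq_bigr => x _.
exact: lf.
Qed.

Lemma functional0 (f : V -> F) : functional f -> f 0 = 0.
Proof. by move=> lf; have := lf (-1) 0 0; rewrite scaler0 addr0 mulN1r addNr. Qed.

Lemma wcoordP h i j a u v :
  wcoord (a *: u + v) h i j = a * wcoord u h i j + wcoord v h i j.
Proof. exact: functional_wcoord. Qed.

Lemma wcoordD h i j u v : wcoord (u + v) h i j = wcoord u h i j + wcoord v h i j.
Proof. by rewrite -[u]scale1r wcoordP mul1r scale1r. Qed.

Lemma wcoordZ h i j a u : wcoord (a *: u) h i j = a * wcoord u h i j.
Proof.
by rewrite -[a *: u]addr0 wcoordP (functional0 _ (functional_wcoord h i j)) addr0.
Qed.

Lemma wcoord0 h i j : wcoord (0 : V) h i j = 0.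
Proof. exact: functional0 (functional_wcoord h i j). Qed.

Lemma wcoordN h i j u : wcoord (- u) h i j = - wcoord u h i j.
Proof. by rewrite -scaleN1r wcoordZ mulN1r. Qed.

Lemma basis_sum v : v = \sum_x v x *: w F n x.2 (val x.1).1 (val x.1).2.
Proof.
apply/ffunP => x; rewrite sum_ffunE.
rewrite {1}wcoordE /wcoord; apply: eq_bigr => y _; rewrite !ffunE /=.
congr (_ * (_)%:R); congr [&& _, _ & _]; exact: eq_sym.
Qed.

(** Two linear forms are equal as soon as they agree on the basis. *)
Lemma functional_ext (f g : V -> F) :
  functional f -> functional g ->
  (forall h i j, (0 < i)%N -> (i < j)%N -> (j <= n)%N ->
     f (w F n h i j) = g (w F n h i j)) ->
  forall v, f v = g v.
Proof.
move=> lf lg fg v.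
have sumE (k : V -> F) : functional k ->
    k v = \sum_x v x * k (w F n x.2 (val x.1).1 (val x.1).2).
  move=> lk; rewrite {1}[v]basis_sum; elim/big_rec2: _ => [|x y1 y2 _ <-].
    exact: functional0.
  exact: lk.
rewrite (sumE f) // (sumE g) //; apply: eq_bigr => -[[[a b] /= p] h] _.
by case/andP: (p) => a0 ab; congr (_ * _); apply: fg => //=; rewrite -ltnS ltn_ord.
Qed.

Lemma wcoord_w h i j h' i' j' :
  (0 < i)%N -> (i < j)%N -> (j <= n)%N ->
  wcoord (w F n h i j) h' i' j' = [&& h == h', i == i' & j == j']%:R.
Proof.
move=> i0 ij jn.
have ltin : (i < n.+1)%N by lia.
have ltjn : (j < n.+1)%N by lia.
have Hp : (0 < (Ordinal ltin, Ordinal ltjn).1)%N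
   && ((Ordinal ltin, Ordinal ltjn).1 < (Ordinal ltin, Ordinal ltjn).2)%N.
  by rewrite /= i0.
pose x0 : wpair n * bool := (exist _ (Ordinal ltin, Ordinal ltjn) Hp, h).
rewrite /wcoord (bigD1 x0) //= [w _ _ _ _ _ x0]ffunE /= !eqxx mul1r big1 ?addr0.
  by rewrite ffunE /=; congr (_%:R); rewrite andbA andbC.
move=> [[[a b] p] g] ne; rewrite ffunE /=.
case: and3P => [[/eqP e1 /eqP e2 /eqP e3]|]; last by rewrite mul0r.
case/eqP: ne; rewrite /x0 e3; congr pair; apply: val_inj => /=.
by congr pair; apply: val_inj.
Qed.

Lemma wcoord_eq u v :
  (forall h i j, (0 < i)%N -> (i < j)%N -> (j <= n)%N ->
     wcoord u h i j = wcoord v h i j) -> u = v.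
Proof.
move=> uv; apply/ffunP => -[[[a b] /= p] h]; rewrite !wcoordE /=.
by case/andP: (p) => a0 ab; apply: uv => //; rewrite -ltnS ltn_ord.
Qed.

(** The next lemmas evaluate on a basis vector the sums of coordinates that
occur in the formulas for the operators. *)
Lemma sum_nat_delta (A : nat -> F) a b s :
  \sum_(a <= x < b) A x * (s == x)%:R = A s * (a <= s < b)%N%:R.
Proof.
case: (boolP (a <= s < b)%N) => sab; last first.
  rewrite mulr0 big_nat_cond big1 // => x /andP[xab _].
  have /negPf-> : s != x by apply: contraNneq sab => ->.
  by rewrite mulr0.
rewrite big_nat_cond (big_rem s) /=; last by rewrite mem_index_iota.
rewrite sab eqxx big_seq_cond big1 ?addr0 // => x.
rewrite mem_rem_uniq ?iota_uniq // inE eq_sym => /andP[/andP[/negPf-> _] _].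
by rewrite mulr0.
Qed.

Lemma sum_wcoord_wl (A : nat -> F) a b h s t h' j :
  (0 < s)%N -> (s < t)%N -> (t <= n)%N ->
  \sum_(a <= x < b) A x * wcoord (w F n h s t) h' x j =
  A s * [&& h == h', t == j & a <= s < b]%N%:R.
Proof.
move=> s0 st tn.
rewrite (eq_bigr (fun x => A x * ((h == h') && (t == j))%:R * (s == x)%:R)).
  by rewrite sum_nat_delta -mulrA -natrM mulnb -andbA.
by move=> x _; rewrite wcoord_w // -mulrA -natrM mulnb -andbA (andbC (s == x)).
Qed.

Lemma sum_wcoord_wr (A : nat -> F) a b h s t h' i :
  (0 < s)%N -> (s < t)%N -> (t <= n)%N ->
  \sum_(a <= x < b) A x * wcoord (w F n h s t) h' i x =
  A t * [&& h == h', s == i & a <= t < b]%N%:R.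
Proof.
move=> s0 st tn.
rewrite (eq_bigr (fun x => A x * ((h == h') && (s == i))%:R * (t == x)%:R)).
  by rewrite sum_nat_delta -mulrA -natrM mulnb -andbA.
by move=> x _; rewrite wcoord_w // -mulrA -natrM mulnb -andbA.
Qed.

Lemma sum2_wcoord_w (A : nat -> nat -> F) a h s t h' :
  (0 < s)%N -> (s < t)%N -> (t <= n)%N ->
  \sum_(a <= x < n.+1) \sum_(x.+1 <= y < n.+1)
     A x y * wcoord (w F n h s t) h' x y =
  A s t * ((h == h') && (a <= s)%N)%:R.
Proof.
move=> s0 st tn.
rewrite (eq_bigr (fun x =>
  A x t * ((h == h') && (x < t < n.+1)%N)%:R * (s == x)%:R)).
  rewrite sum_nat_delta -mulrA -natrM mulnb.
  have -> : (s < t < n.+1)%N by lia.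
  have -> : (a <= s < n.+1)%N = (a <= s)%N by lia.
  by rewrite andbT.
move=> x _; rewrite sum_wcoord_wr // -mulrA -natrM mulnb -andbA.
by rewrite (andbC (s == x)).
Qed.

End Coordinates.

Section CommonEigenvectors.
Set Implicit Arguments.
Variables (F : fieldType) (l r : F) (n : nat).
Local Notation V := (Vn F n).
Local Notation m := (mpar r).
Implicit Types (u v : V) (h : bool) (i j k s t : nat).

(** * The operators in coordinates *)

Lemma functional_wcoord_nu k h i j :
  functional (fun v => wcoord (nu l r n k v) h i j).
Proof. by move=> a u v; rewrite linearP wcoordP. Qed.

Ltac functional_tac := repeat first
  [ exact: functional_wcoord_nu | exact: functional_wcoord
  | apply: functional_add | apply: functional_opp | apply: functional_mul
  | apply: functional_sum => ? ].

(* Decides all the comparisons of indices, discarding inconsistent cases. *)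
Ltac bool_cases := repeat (match goal with
 | |- context [@eq_op _ ?a ?b] =>
     case: (@eqVneq _ a b) => ?; subst; try (exfalso; lia)
 | |- context [leq ?a ?b] => case: (leqP a b) => ?; try (exfalso; lia)
 end; rewrite /=).

(* Reduces an equality of linear forms to its instance at [w g a b]. *)
Ltac nu_tac := apply: functional_ext; [functional_tac | functional_tac |
  move=> g a b a0 ab bn; rewrite nu_w // /nu_img].

Ltac eval_wcoord :=
  rewrite ?(wcoordD, wcoordN, wcoordZ)
          ?(sum2_wcoord_w, sum_wcoord_wl, sum_wcoord_wr) ?wcoord_w;
  try lia; bool_cases; rewrite ?invfM; try ring.

Ltac nuk_tac v := move: v; nu_tac; [idtac];
  match goal with |- context [if (?k.+1 == 1)%N then _ else _] =>
    rewrite (_ : (k.+1 == 1)%N = false); [|lia] end;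
  rewrite /nuk_img /=; bool_cases;
  try match goal with |- context [if ?g then _ else _] => case: g end;
  eval_wcoord.

(** The operator [nu k.+1], for [1 <= k < n]: in the names below, [i] or [j]
tells which index of the pair lies in [{k, k.+1}], and [l] or [r] whether it is
[k] or [k.+1]. *)
Lemma wcoord_nuk_il k h t v : (0 < k)%N -> (k.+1 < t)%N -> (t <= n)%N ->
  wcoord (nu l r n k.+1 v) h k t = wcoord v h k.+1 t.
Proof. by move=> k0 kt tn; nuk_tac v. Qed.

Lemma wcoord_nuk_ir k h t v : (0 < k)%N -> (k.+1 < t)%N -> (t <= n)%N ->
  wcoord (nu l r n k.+1 v) h k.+1 t = wcoord v h k t - m * wcoord v h k.+1 t.
Proof. by move=> k0 kt tn; nuk_tac v. Qed.

Lemma wcoord_nuk_jl k h s v : (0 < s)%N -> (s < k)%N -> (k < n)%N ->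
  wcoord (nu l r n k.+1 v) h s k = wcoord v h s k.+1.
Proof. by move=> s0 sk kn; nuk_tac v. Qed.

Lemma wcoord_nuk_jr k h s v : (0 < s)%N -> (s < k)%N -> (k < n)%N ->
  wcoord (nu l r n k.+1 v) h s k.+1 = wcoord v h s k - m * wcoord v h s k.+1.
Proof. by move=> s0 sk kn; nuk_tac v. Qed.

Lemma wcoord_nuk_disjoint k h s t v :
  (0 < k)%N -> (k < n)%N -> (0 < s)%N -> (s < t)%N -> (t <= n)%N ->
  s \notin [:: k; k.+1] -> t \notin [:: k; k.+1] ->
  wcoord (nu l r n k.+1 v) h s t = r * wcoord v h s t.
Proof.
rewrite !inE !negb_or => k0 kn s0 st tn.
move=> /andP[/eqP sk /eqP sk'] /andP[/eqP tk /eqP tk'].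
by nuk_tac v.
Qed.

Lemma wcoord_nuk_hat k v : (0 < k)%N -> (k < n)%N ->
  wcoord (nu l r n k.+1 v) true k k.+1 = r * wcoord v true k k.+1.
Proof. by move=> k0 kn; nuk_tac v. Qed.

Lemma wcoord_nuk_unhat k v : (0 < k)%N -> (k < n)%N ->
  wcoord (nu l r n k.+1 v) false k k.+1 =
    l^-1 * wcoord v false k k.+1
    + \sum_(k.+2 <= t < n.+1)
         m / l * r ^ (t%:Z - k.+1%:Z - 2) * wcoord v true k.+1 t
    + \sum_(k.+2 <= t < n.+1) m * r ^ (t%:Z - k.+1%:Z - 1) * wcoord v false k.+1 t
    + \sum_(1 <= s < k) m / l / r ^ (k.+1%:Z - s%:Z - 2) * wcoord v true s k.+1
    + \sum_(1 <= s < k) m / l / r ^ (k.+1%:Z - s%:Z - 2) * wcoord v false s k.+1.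
Proof. by move=> k0 kn; nuk_tac v. Qed.

(* The three cases are [a = 1], [a = 2] and [a >= 3]. *)
Ltac nu1_tac v := move: v; nu_tac; rewrite /nu1_img /=;
  match goal with
    a0 : is_true (leq 1 ?a), ab : is_true (leq (S ?a) ?b)
    |- context [if leq 3 ?a then (if ?g then _ else _) else _] =>
    move: a0 ab; case: g; case: a => [|[|[|?]]] //= ? ? end;
  bool_cases; eval_wcoord.

Lemma wcoord_nu1_rest h i j v : (2 < i)%N -> (i < j)%N -> (j <= n)%N ->
  wcoord (nu l r n 1 v) h i j = r * wcoord v h i j.
Proof. by move=> i2 ij jn; nu1_tac v. Qed.

Lemma wcoord_nu1_1j_unhat j v : (2 < j)%N -> (j <= n)%N ->
  wcoord (nu l r n 1 v) false 1 j =
    wcoord v true 2 j - m * wcoord v false 1 j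
    - \sum_(j.+1 <= t < n.+1) m * r ^ (t%:Z - 5) * wcoord v true j t
    - \sum_(3 <= s < j) m * r ^ (s%:Z - 3) * wcoord v true s j.
Proof. by move=> j2 jn; nu1_tac v. Qed.

Lemma wcoord_nu1_1j_hat j v : (2 < j)%N -> (j <= n)%N ->
  wcoord (nu l r n 1 v) true 1 j =
    wcoord v false 2 j + m * wcoord v false 1 j
    + \sum_(j.+1 <= t < n.+1) m * r ^ (t%:Z - 5) * wcoord v true j t
    + \sum_(3 <= s < j) m * r ^ (s%:Z - 3) * wcoord v true s j.
Proof. by move=> j2 jn; nu1_tac v. Qed.

Lemma wcoord_nu1_2j_unhat j v : (2 < j)%N -> (j <= n)%N ->
  wcoord (nu l r n 1 v) false 2 j =
    wcoord v true 1 j - m * wcoord v true 2 j - m * wcoord v false 2 j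
    - \sum_(j.+1 <= t < n.+1) m * r ^ (t%:Z - 4) * wcoord v true j t
    - \sum_(3 <= s < j) m * r ^ (s%:Z - 2) * wcoord v true s j.
Proof. by move=> j2 jn; nu1_tac v. Qed.

Lemma wcoord_nu1_2j_hat j v : (2 < j)%N -> (j <= n)%N ->
  wcoord (nu l r n 1 v) true 2 j =
    wcoord v false 1 j
    + \sum_(j.+1 <= t < n.+1) m * r ^ (t%:Z - 4) * wcoord v true j t
    + \sum_(3 <= s < j) m * r ^ (s%:Z - 2) * wcoord v true s j.
Proof. by move=> j2 jn; nu1_tac v. Qed.

Lemma wcoord_nu1_12_unhat v : (1 < n)%N ->
  wcoord (nu l r n 1 v) false 1 2 =
    r * wcoord v false 1 2
    + \sum_(3 <= j < n.+1) m * r ^ (j%:Z - 3) * wcoord v true 2 j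
    - \sum_(3 <= j < n.+1) m * r ^ (j%:Z - 4) * wcoord v false 1 j
    - \sum_(3 <= i < n.+1) \sum_(i.+1 <= j < n.+1)
        m ^+ 2 * (r ^ (i%:Z + j%:Z - 8) + r ^ (i%:Z + j%:Z - 6))
        * wcoord v true i j.
Proof. by move=> n1; nu1_tac v. Qed.

Lemma wcoord_nu1_12_hat v : (1 < n)%N ->
  wcoord (nu l r n 1 v) true 1 2 =
    l^-1 * wcoord v true 1 2
    + \sum_(3 <= j < n.+1) m * r ^ (j%:Z - 3) * wcoord v false 2 j
    + \sum_(3 <= j < n.+1) m * r ^ (j%:Z - 4) * wcoord v false 1 j
    + \sum_(3 <= i < n.+1) \sum_(i.+1 <= j < n.+1)
        m ^+ 2 * (r ^ (i%:Z + j%:Z - 8) + r ^ (i%:Z + j%:Z - 6))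
        * wcoord v true i j.
Proof. by move=> n1; nu1_tac v. Qed.

(** * Vectors with coordinates [c_h r^(i+j)] *)

Hypothesis r_neq0 : r != 0.

Lemma expr_subz t (c : nat) : r ^ (t%:Z - c%:R) = r ^+ t / r ^+ c.
Proof. by rewrite expfzDr // natz -exprnN -exprnP. Qed.

Lemma expr_addz i j (c : nat) :
  r ^ (i%:Z + j%:Z - c%:R) = r ^+ i * r ^+ j / r ^+ c.
Proof. by rewrite -PoszD expr_subz exprD. Qed.

Lemma expr_subz2 t s (c : nat) :
  r ^ (t%:Z - s%:Z - c%:R) = r ^+ t / (r ^+ s * r ^+ c).
Proof.
by rewrite -addrA -opprD natz -PoszD -[Posz (s + c)]natz expr_subz exprD.
Qed.

Lemma expr_subz1 t s : r ^ (t%:Z - s%:Z - 1) = r ^+ t / (r ^+ s * r).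
Proof. exact: (expr_subz2 t s 1). Qed.

(** The sum telescopes, as [m r^(2t) = r^(2t-1) - r^(2t+1)]. *)
Lemma geometric_sum a b : (a <= b)%N ->
  \sum_(a <= t < b) m * (r ^+ t) ^+ 2 = ((r ^+ a) ^+ 2 - (r ^+ b) ^+ 2) / r.
Proof.
move/subnK<-; elim: (b - a)%N => [|d IHd].
  by rewrite add0n big_geq // subrr mul0r.
rewrite addSn big_nat_recr ?leq_addl //= IHd (exprS r) /mpar.
by field.
Qed.

(** After summation over [t], the sum over [s] involves [m r^(4s)], which
telescopes once multiplied by [1 + r^2]; this factor is kept on the left, so
that it need not be invertible. *)
Lemma geometric_sum2 a b : (a <= b)%N ->
  (1 + r ^+ 2) * (\sum_(a <= s < b) \sum_(s.+1 <= t < b)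
      m ^+ 2 * ((r ^+ s) ^+ 2 * (r ^+ t) ^+ 2)) =
  ((r ^+ a) ^+ 4 - (r ^+ b) ^+ 4)
   - (1 + r ^- 2) * (r ^+ b) ^+ 2 * ((r ^+ a) ^+ 2 - (r ^+ b) ^+ 2).
Proof.
move=> ab.
rewrite (eq_big_nat _ _ (F2 := fun s => m * (r ^+ s) ^+ 2 *
   (((r ^+ s.+1) ^+ 2 - (r ^+ b) ^+ 2) / r))); last first.
  move=> s /andP[_ sb]; rewrite -geometric_sum // mulr_sumr.
  by apply: eq_bigr => t _; ring.
(* The bound of the inner sums is separated from that of the outer sum, on
   which the induction runs. *)
have gen c B : (a <= c)%N ->
   (1 + r ^+ 2) * (\sum_(a <= s < c) m * (r ^+ s) ^+ 2 *
     (((r ^+ s.+1) ^+ 2 - B ^+ 2) / r)) =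
   (r ^+ a) ^+ 4 - (r ^+ c) ^+ 4
   - (1 + r ^- 2) * B ^+ 2 * ((r ^+ a) ^+ 2 - (r ^+ c) ^+ 2).
  move/subnK<-; elim: (c - a)%N => [|d IHd].
    by rewrite add0n big_geq // !subrr !mulr0 subrr.
  rewrite addSn big_nat_recr ?leq_addl //= mulrDr IHd !(exprS r) /mpar.
  by field.
exact: gen.
Qed.

Lemma sum_geometric K (E : nat -> F) a b : (a <= b)%N ->
  (forall t, (a <= t < b)%N -> E t = K * (m * (r ^+ t) ^+ 2)) ->
  \sum_(a <= t < b) E t = K * (((r ^+ a) ^+ 2 - (r ^+ b) ^+ 2) / r).
Proof.
by move=> ab EK; rewrite (eq_big_nat _ _ EK) -mulr_sumr geometric_sum.
Qed.

(** The vectors whose coordinates are [c true r^(i+j)] at the hatted basis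
vectors and [c false r^(i+j)] at the others. *)
Definition shaped (c : bool -> F) v :=
  forall h i j, (0 < i)%N -> (i < j)%N -> (j <= n)%N ->
    wcoord v h i j = c h * r ^+ (i + j).

Ltac field_r := field; rewrite ?oner_neq0 ?expf_neq0 ?r_neq0.

(* Evaluates the first sum of the goal, [K] being the ratio of its general term
   to [m r^(2t)] for the vector described by [cv]. *)
Ltac shaped_sum cv K :=
  rewrite (@sum_geometric K); [| lia | let t := fresh in let T := fresh in
    move=> t T; rewrite cv ?(expr_subz2, expr_subz1, expr_addz, expr_subz) ?exprD;
    [by field_r | lia ..] ].

Lemma shaped_nuk c k v : shaped c v -> (0 < k)%N -> (k < n)%N ->
  wcoord (nu l r n k.+1 v) false k k.+1 =
    l^-1 * (c true * (r ^+ 3 - (r ^+ n) ^+ 2 / r) + c false * r ^+ 3)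
    + c false * ((r ^+ k.+1) ^+ 2 - (r ^+ n) ^+ 2).
Proof.
move=> cv k0 kn; rewrite wcoord_nuk_unhat //; move: l^-1 => L.
shaped_sum cv (L * c true / r ^+ 2).
shaped_sum cv (c false / r).
shaped_sum cv (L * c true * r ^+ 2).
shaped_sum cv (L * c false * r ^+ 2).
rewrite cv; try lia.
rewrite addnS !(exprS r) exprD.
by field.
Qed.

(** The sums occurring in the coordinates of [nu 1 v] at [(1,j)], at [(2,j)] and
at [(1,2)]. *)
Lemma shaped_sum_1j c j v : shaped c v -> (2 < j)%N -> (j <= n)%N ->
  \sum_(j.+1 <= t < n.+1) m * r ^ (t%:Z - 5) * wcoord v true j t
  + \sum_(3 <= s < j) m * r ^ (s%:Z - 3) * wcoord v true s j =
  c true * (r ^+ j * r ^+ 2 - (r ^+ n) ^+ 2 * r ^+ j / r ^+ 4).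
Proof.
move=> cv j2 jn.
shaped_sum cv (c true * r ^+ j / r ^+ 5).
shaped_sum cv (c true * r ^+ j / r ^+ 3).
by rewrite !(exprS r); field.
Qed.

Lemma shaped_sum_2j c j v : shaped c v -> (2 < j)%N -> (j <= n)%N ->
  \sum_(j.+1 <= t < n.+1) m * r ^ (t%:Z - 4) * wcoord v true j t
  + \sum_(3 <= s < j) m * r ^ (s%:Z - 2) * wcoord v true s j =
  c true * (r ^+ j * r ^+ 3 - (r ^+ n) ^+ 2 * r ^+ j / r ^+ 3).
Proof.
move=> cv j2 jn.
shaped_sum cv (c true * r ^+ j / r ^+ 4).
shaped_sum cv (c true * r ^+ j / r ^+ 2).
by rewrite !(exprS r); field.
Qed.

Lemma shaped_sum_12 c v : shaped c v -> (1 < n)%N ->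
  \sum_(3 <= i < n.+1) \sum_(i.+1 <= j < n.+1)
        m ^+ 2 * (r ^ (i%:Z + j%:Z - 8) + r ^ (i%:Z + j%:Z - 6))
        * wcoord v true i j =
  c true * (r ^+ 4 - (r ^+ n) ^+ 4 / r ^+ 4
            - (1 + r ^+ 2) * ((r ^+ n) ^+ 2 / r ^+ 2 - (r ^+ n) ^+ 4 / r ^+ 6)).
Proof.
move=> cv n1.
(* [r^-8 + r^-6 = r^-8 (1 + r^2)] provides the factor of [geometric_sum2]. *)
have -> : c true * (r ^+ 4 - (r ^+ n) ^+ 4 / r ^+ 4
            - (1 + r ^+ 2) * ((r ^+ n) ^+ 2 / r ^+ 2 - (r ^+ n) ^+ 4 / r ^+ 6))
   = c true / r ^+ 8 * ((1 + r ^+ 2) *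
      (\sum_(3 <= s < n.+1) \sum_(s.+1 <= t < n.+1)
         m ^+ 2 * ((r ^+ s) ^+ 2 * (r ^+ t) ^+ 2))).
  by rewrite geometric_sum2 //; rewrite (exprS _ n); field.
rewrite mulrA mulr_sumr; apply: eq_big_nat => i i3n.
rewrite mulr_sumr; apply: eq_big_nat => j jn.
by rewrite cv ?expr_addz ?exprD; [field_r | lia..].
Qed.

(** * Sufficiency of the two relations *)

(** The relations between [c true], [c false] and [l] are written with [r ^+ n]
only: they read [c false = r^(2n-4) c true] and [l^-1 = r^(4n-7)]. *)

Section Sufficiency.
Variables (c : bool -> F) (v : V).
Hypotheses (n_ge2 : (2 <= n)%N) (cv : shaped c v).
Hypotheses (cE : c false = c true * ((r ^+ n) ^+ 2 / r ^+ 4))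
  (lE : l^-1 = (r ^+ n) ^+ 4 / r ^+ 7).

Lemma shaped_nuk_eigen k : (0 < k)%N -> (k < n)%N ->
  nu l r n k.+1 v = r *: v.
Proof.
move=> k0 kn; apply: wcoord_eq => h i j i0 ij jn; rewrite wcoordZ.
have [ik|ik] := eqVneq i k; have [jk|jk] := eqVneq j k;
  have [ik1|ik1] := eqVneq i k.+1; have [jk1|jk1] := eqVneq j k.+1;
  subst; try (exfalso; lia).
- case: h; first by rewrite wcoord_nuk_hat.
  rewrite (shaped_nuk k cv) // cv // lE cE exprD.
  by rewrite (exprS r k); field_r.
- by rewrite wcoord_nuk_il ?cv ?addSn ?(exprS r); try lia; ring.
- by rewrite wcoord_nuk_jl ?cv ?addnS ?(exprS r); try lia; ring.
- by rewrite wcoord_nuk_ir ?cv ?addSn ?(exprS r) /mpar; try lia; field.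
- by rewrite wcoord_nuk_jr ?cv ?addnS ?(exprS r) /mpar; try lia; field.
- by rewrite wcoord_nuk_disjoint // !inE !negb_or ?ik ?ik1 ?jk ?jk1.
Qed.

Lemma shaped_nu1_eigen : nu l r n 1 v = r *: v.
Proof.
apply: wcoord_eq => h [|[|[|i]]] j // _ ij jn; rewrite wcoordZ; last first.
- by rewrite wcoord_nu1_rest.
- case: h.
    rewrite wcoord_nu1_2j_hat // -addrA (shaped_sum_2j j cv) ?cv //; try lia.
    by rewrite cE !exprD; field_r.
  rewrite wcoord_nu1_2j_unhat // -addrA -opprD (shaped_sum_2j j cv) ?cv //;
    try lia.
  by rewrite cE !exprD /mpar; field_r.
have [->|j2] := eqVneq j 2; last first.
  have {}j2 : (2 < j)%N by lia.
  case: h.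
    rewrite wcoord_nu1_1j_hat // -addrA (shaped_sum_1j j cv) ?cv //; try lia.
    by rewrite cE !exprD /mpar; field_r.
  rewrite wcoord_nu1_1j_unhat // -addrA -opprD (shaped_sum_1j j cv) ?cv //; try lia.
  by rewrite cE !exprD /mpar; field_r.
case: h.
  rewrite wcoord_nu1_12_hat // (shaped_sum_12 cv) //.
  shaped_sum cv (c false / r).
  shaped_sum cv (c false / r ^+ 3).
  by rewrite cv // cE lE (exprS r n); field.
rewrite wcoord_nu1_12_unhat // (shaped_sum_12 cv) //.
shaped_sum cv (c true / r).
shaped_sum cv (c false / r ^+ 3).
by rewrite cv // cE (exprS r n); field.
Qed.

End Sufficiency.

(** * The shape of a common eigenvector *)

(** Deduces an equation from a multiple of it. *)
Lemma eq_of_scaled (k x y x' y' : F) : x = y -> x' - y' = k * (x - y) -> x' = y'.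
Proof. by move=> ->; rewrite subrr mulr0 => /subr0_eq. Qed.

Lemma eigen_wcoord_j k s h a v : nu l r n k.+1 v = a *: v ->
    (0 < s)%N -> (s < k)%N -> (k < n)%N ->
  wcoord v h s k.+1 = a * wcoord v h s k /\
  wcoord v h s k = (a + m) * wcoord v h s k.+1.
Proof.
move=> ev s0 sk kn; split; first by rewrite -wcoordZ -ev wcoord_nuk_jl.
by rewrite mulrDl -wcoordZ -ev wcoord_nuk_jr // subrK.
Qed.

Lemma eigen_wcoord_i k t h a v : nu l r n k.+1 v = a *: v ->
    (0 < k)%N -> (k.+1 < t)%N -> (t <= n)%N ->
  wcoord v h k.+1 t = a * wcoord v h k t /\
  wcoord v h k t = (a + m) * wcoord v h k.+1 t.
Proof.
move=> ev k0 kt tn; split; first by rewrite -wcoordZ -ev wcoord_nuk_il.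
by rewrite mulrDl -wcoordZ -ev wcoord_nuk_ir // subrK.
Qed.

Section Eigenvector.
Variables (a : nat -> F) (v : V).
Hypotheses (n_ge4 : (4 <= n)%N) (v_neq0 : v != 0).
Hypothesis av : forall k, (0 < k <= n)%N -> nu l r n k v = a k *: v.

(** For a given [h], the coordinates of a common eigenvector are all zero or all
nonzero: one passes from any pair to [(1,2)] by steps lowering one index by 1. *)
Lemma eigen_wcoord_eq0 h i j : (0 < i)%N -> (i < j)%N -> (j <= n)%N ->
  (wcoord v h i j == 0) = (wcoord v h 1 2 == 0).
Proof.
have iff0 (x y b c : F) : x = b * y /\ y = c * x -> (x == 0) = (y == 0).
  by case=> xy yx; apply/eqP/eqP => [x0|y0]; [rewrite yx x0 | rewrite xy y0];
    rewrite mulr0.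
elim: i => // -[_ _ | i IHi _ ij jn].
  elim: j => // -[|[|j]] // IHj _ jn; rewrite -IHj //; last by lia.
  by apply: iff0; apply: eigen_wcoord_j; rewrite ?av //; lia.
rewrite -IHi //; last by lia.
by apply: iff0; apply: eigen_wcoord_i; rewrite ?av //; lia.
Qed.

Lemma eigenvalue_r k : (0 < k <= n)%N -> a k = r.
Proof.
have [h h12] : exists h, wcoord v h 1 2 != 0.
  apply: contra_neqP v_neq0 => /forallNP v12; apply: wcoord_eq => h i j i0 ij jn.
  by rewrite wcoord0; apply/eqP; rewrite eigen_wcoord_eq0 // -[_ == _]negbK;
    apply/negP/v12.
have nz i j : (0 < i)%N -> (i < j)%N -> (j <= n)%N -> wcoord v h i j != 0.
  by move=> i0 ij jn; rewrite eigen_wcoord_eq0.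
have fromE i j : (0 < i)%N -> (i < j)%N -> (j <= n)%N ->
    wcoord (nu l r n k v) h i j = r * wcoord v h i j -> (0 < k <= n)%N -> a k = r.
  by move=> i0 ij jn + kn; rewrite av // wcoordZ => /(mulIf (nz _ _ i0 ij jn)).
(* A pair disjoint from [{k-1, k}] is (3,4) for k = 2, (1,4) for k = 3 and (1,2)
   for k >= 4; the pair (3,4) also serves for k = 1. *)
case: k fromE => [|[|[|[|k]]]] fromE // kn.
- by apply: (fromE 3 4) => //; rewrite wcoord_nu1_rest.
- by apply: (fromE 3 4) => //; rewrite wcoord_nuk_disjoint //; lia.
- by apply: (fromE 1 4) => //; rewrite wcoord_nuk_disjoint //; lia.
- by apply: (fromE 1 2) => //; try lia; rewrite wcoord_nuk_disjoint //; lia.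
Qed.

Lemma eigen_shaped : exists c, shaped c v.
Proof.
exists (fun h => wcoord v h 1 2 / r ^+ 3).
have ev k : (0 < k <= n)%N -> nu l r n k v = r *: v.
  by move=> kn; rewrite av // eigenvalue_r.
move=> h i j; elim: i => // -[_ _ | i IHi _ ij jn].
  elim: j => // -[|[|j]] // IHj _ jn; first by field.
  have [//|//|//|//|-> _] := @eigen_wcoord_j j.+2 1 h _ _ (ev j.+3 _).
  rewrite IHj //; last by lia.
  by rewrite !addnS (exprS r (_ + _).+2); ring.
have [|//|//|//|-> _] := @eigen_wcoord_i i.+1 j h _ _ (ev i.+2 _); first by lia.
by rewrite IHi ?addSn ?(exprS r (_ + _).+1) //; try lia; ring.
Qed.

End Eigenvector.

(** From the coordinate of [nu 1 v] at [w_13]. *)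
Lemma shaped_eigen_coef c v :
  (3 <= n)%N -> shaped c v -> nu l r n 1 v = r *: v ->
  c false = c true * ((r ^+ n) ^+ 2 / r ^+ 4).
Proof.
move=> n3 cv ev.
have := wcoord_nu1_1j_unhat 3 v isT n3.
rewrite -addrA -opprD (shaped_sum_1j 3 cv) // ev.
rewrite wcoordZ !cv //; try lia.
move: (c false) (c true) (r ^+ n) => x y N; rewrite /mpar => eqxy.
by apply: (eq_of_scaled (r ^- 3) _ _ eqxy); field_r.
Qed.

(** From the coordinate of [nu 2 v] at [w_12]. *)
Lemma shaped_eigen_l c v :
  (2 <= n)%N -> shaped c v -> nu l r n 2 v = r *: v ->
  l^-1 * (c true * (r ^+ 3 - (r ^+ n) ^+ 2 / r) + c false * r ^+ 3) =
    c false * (r ^+ n) ^+ 2.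
Proof.
move=> n2 cv ev.
have := shaped_nuk 1 cv isT n2.
rewrite ev wcoordZ cv //; move: (c false) (c true) (r ^+ n) => x y N eqxy.
by apply: (eq_of_scaled (-1) _ _ eqxy); move: l^-1 => L; field_r.
Qed.

(** * Invariant lines *)

Hypothesis n_ge4 : (4 <= n)%N.

Lemma uvec_shaped :
  shaped (fun h => if h then 1 else (r ^+ n) ^+ 2 / r ^+ 4) (uvec r n).
Proof.
move=> h i j i0 ij jn.
(* The scalar product defining the coordinates is symmetric. *)
have sym h' s t : wcoord (w F n h' s t) h i j = wcoord (w F n h i j) h' s t.
  by apply: eq_bigr => x _; rewrite mulrC.
have sumE (I : Type) (s : seq I) (f : I -> Vn F n) :
    wcoord (\sum_(x <- s) f x) h i j = \sum_(x <- s) wcoord (f x) h i j.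
  elim/big_rec2: _ => [|x y z _ <-]; last by rewrite wcoordD.
  exact: wcoord0.
rewrite sumE (eq_bigr (fun s =>
   \sum_(s.+1 <= t < n.+1) r ^+ (s + t) * wcoord (w F n h i j) true s t
   + \sum_(s.+1 <= t < n.+1) r ^+ (s + t) * r ^+ (2 * n - 4)
        * wcoord (w F n h i j) false s t)); last first.
  move=> s _; rewrite sumE -big_split; apply: eq_bigr => t _ /=.
  by rewrite wcoordZ wcoordD wcoordZ !sym mulrDr mulrA.
rewrite big_split /= !sum2_wcoord_w // i0 !andbT.
have -> : r ^+ (2 * n - 4) = (r ^+ n) ^+ 2 / r ^+ 4.
  by rewrite -exprM mulnC -expfB_cond ?(negPf r_neq0) //=; lia.
case: h {sym sumE}; rewrite ?mulr1 ?mulr0 ?addr0 ?add0r; first by rewrite mul1r.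
exact: mulrC.
Qed.

Lemma inv_l_E : (l = 1 / r ^+ (4 * n - 7)) <-> (l^-1 = (r ^+ n) ^+ 4 / r ^+ 7).
Proof.
have <- : r ^+ (4 * n - 7) = (r ^+ n) ^+ 4 / r ^+ 7.
  by rewrite -exprM mulnC -expfB_cond ?(negPf r_neq0) //=; lia.
by rewrite div1r; split=> [->|<-]; rewrite invrK.
Qed.

Lemma invariant_line (v : Vn F n) :
  invariant_subspace l r <[v]>%VS <->
  forall k, (0 < k <= n)%N -> exists a, nu l r n k v = a *: v.
Proof.
split=> H k kn; first by apply/vlineP; have:= H k kn; rewrite limg_line.
by rewrite limg_line -memvE; apply/vlineP/H.
Qed.

Lemma uvec_neq0 : uvec r n != 0.
Proof.
apply: contra_neq (oner_neq0 F) => u0; have n2 : (2 <= n)%N by lia.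
have := uvec_shaped true 1 2 isT isT n2.
rewrite u0 wcoord0 mul1r => /esym/eqP.
by rewrite expf_eq0 (negPf r_neq0) andbF.
Qed.

Lemma uvec_line_invariant : l = 1 / r ^+ (4 * n - 7) ->
  \dim <[uvec r n]>%VS = 1%N /\ invariant_subspace l r <[uvec r n]>%VS.
Proof.
move=> /inv_l_E lE; split; first by rewrite dim_vline uvec_neq0.
have n2 : (2 <= n)%N by lia.
apply/invariant_line => -[|[|k]] // kn; exists r.
  by apply: (shaped_nu1_eigen n2 uvec_shaped); rewrite // mul1r.
by apply: (shaped_nuk_eigen n2 uvec_shaped); rewrite // mul1r.
Qed.

Lemma invariant_line_uvec (U : {vspace Vn F n}) :
  \dim U = 1%N -> invariant_subspace l r U ->
  l = 1 / r ^+ (4 * n - 7) /\ U = <[uvec r n]>%VS.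
Proof.
move=> dimU; have U_neq0 : U != 0%VS by rewrite -dimv_eq0 dimU.
have v_neq0 : vpick U != 0 by rewrite vpick0.
have UE : U = <[vpick U]>%VS.
  by apply/esym/eqP; rewrite eqEdim -memvE memv_pick dim_vline v_neq0 dimU.
rewrite UE; move: (vpick U) v_neq0 => v v_neq0 {UE U_neq0 dimU}.
move=> /invariant_line Hv.
have [a av] : exists a, forall k, (0 < k <= n)%N -> nu l r n k v = a k *: v.
  have /choice[a Ha] : forall k,
      exists a, (0 < k <= n)%N -> nu l r n k v = a *: v.
    move=> k; case: (boolP (0 < k <= n)%N) => [/Hv[a ->]|_]; first by exists a.
    by exists 0.
  by exists a.
have rv k : (0 < k <= n)%N -> nu l r n k v = r *: v.
  by move=> kn; rewrite av // (eigenvalue_r a n_ge4 v_neq0 av).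
have [c cv] := eigen_shaped a n_ge4 v_neq0 av.
have n3 : (3 <= n)%N by lia.
have n2 : (2 <= n)%N by lia.
have n1 : (0 < 1 <= n)%N by lia.
have cE := shaped_eigen_coef n3 cv (rv 1 n1).
have lE := shaped_eigen_l n2 cv (rv 2 n2).
have vE : v = c true *: uvec r n.
  apply: wcoord_eq => h i j i0 ij jn; rewrite wcoordZ cv // uvec_shaped // mulrA.
  by case: h; rewrite ?mulr1 ?cE.
have c_neq0 : c true != 0 by apply: contra_neq v_neq0 => c0; rewrite vE c0 scale0r.
split.
  apply/inv_l_E; move: lE; rewrite cE => eqN.
  by apply: (eq_of_scaled ((c true * r ^+ 3)^-1) _ _ eqN);
     move: (l^-1) => L; field; rewrite c_neq0 r_neq0.
rewrite vE; apply/eqP; rewrite eqEsubv -!memvE; apply/andP; split.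
  by rewrite memvZ // memv_line.
by apply/vlineP; exists (c true)^-1; rewrite scalerA mulVf // scale1r.
Qed.

End CommonEigenvectors.

Theorem theorem3 (R : realType) (n : nat) (l r : R[i]) (hn : (4 <= n)%N)
    (hl : l != 0) (hr : r != 0)
    (hr1 : forall k : nat, (1 <= k <= n)%N -> r ^+ (2 * k) != 1)
    (hr2 : forall k : nat, (1 <= k <= n - 1)%N -> r ^+ (2 * k) != -1) :
  let F := Qadj l r in
  let lF : F := Qadj_l l r in
  let rF : F := Qadj_r l r in
  ((exists U : {vspace Vn F n}, \dim U = 1%N /\ invariant_subspace lF rF U)
     <-> l = 1 / r ^+ (4 * n - 7))
  /\ (l = 1 / r ^+ (4 * n - 7) ->
      forall U : {vspace Vn F n},
        (\dim U = 1%N /\ invariant_subspace lF rF U)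
          <-> U = <[uvec rF n]>%VS).
Proof.
move=> F lF rF.
have rF_neq0 : rF != 0 by apply: contra_neq hr => /(congr1 val).
(* The inclusion of Q(l,r) into the complex numbers is injective. *)
have lFE : (lF = 1 / rF ^+ (4 * n - 7)) <-> (l = 1 / r ^+ (4 * n - 7)).
  have valE : val (1 / rF ^+ (4 * n - 7)) = 1 / r ^+ (4 * n - 7).
    by rewrite !div1r fmorphV rmorphXn.
  by split=> [/(congr1 val)|lE]; [rewrite valE | apply: val_inj; rewrite valE].
split; first split.
- by case=> U [dimU /(invariant_line_uvec rF_neq0 hn dimU)[/lFE]].
- by move=> /lFE lE; exists <[uvec rF n]>%VS; apply: uvec_line_invariant.
- move=> /lFE lE U; split=> [[dimU Uinv]|->].
    by have [] := invariant_line_uvec rF_neq0 hn dimU Uinv.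
  exact: uvec_line_invariant.
Qed.
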